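(* Let $\mathbb{K}$ be a field and let $H$ be a positive affine semigroup. Then there exists a finite set $\mathscr{A}\subseteq H$ generating $H$ as a monoid such that, if $\mathbb{K}[H]$ is Cohen--Macaulay, then the $\mathscr{A}$-Newton graded ring $\mathrm{gr}^{\mathscr{A}}(\mathbb{K}[H])$ is Cohen--Macaulay.
   Context: An affine semigroup is a finitely generated, commutative, torsion-free, cancellative monoid; it is positive if $0$ is its only invertible element. $\mathbb{Z}H$ is the Grothendieck group of $H$, of rank $r$; $\mathbb{Q}H=\mathbb{Q}\otimes_{\mathbb{Z}}\mathbb{Z}H$, and $H\subseteq\mathbb{Z}H\subseteq\mathbb{Q}H$. $\mathbb{K}[H]=\bigoplus_{h\in H}\mathbb{K}\,t^h$ is the semigroup ring. For a finite generating set $\mathscr{A}$ of $H$ let $\Delta$ be the convex hull of $\mathscr{A}\cup\{0\}$ in $\mathbb{Q}H$. For each $(r-1)$-dimensional face $\sigma$ of $\Delta$ not containing $0$ let $\ell_\sigma$ be the unique linear form on $\mathbb{Q}H$ with $\max\ell_\sigma(\Delta)=1$ and $\ell_\sigma^{-1}(1)\cap\Delta=\sigma$. The Newton $\mathscr{A}$-degree of $h\in H$ is $\deg_{\mathscr{A}}(h)=\max_\sigma \ell_\sigma(h)\in\mathbb{Q}$, the maximum over all such $\sigma$. It is subadditive and defines the increasing Newton filtration $N_k\mathbb{K}[H]=\bigoplus_{h\in H,\ \deg_{\mathscr{A}}(h)\le k}\mathbb{K}\,t^h$, $k\in\mathbb{Q}$, of $\mathbb{K}[H]$. The ring $\mathrm{gr}^{\mathscr{A}}(\mathbb{K}[H])=\bigoplus_k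 N_k/N_{<k}$ is the associated graded ring. *)

(* Defs.v *)
From HB Require Import structures.
From mathcomp Require Import all_boot all_order all_algebra.
From mathcomp Require Import finmap monalg.
From mathcomp Require Import boolp classical_sets.

Set Implicit Arguments.
Unset Strict Implicit.
Unset Printing Implicit Defensive.

Import Order.TTheory GRing.Theory Num.Theory.

Local Open Scope ring_scope.
Local Open Scope quotient_scope.
Local Open Scope classical_set_scope.

(** A [conomType] is a commutative monoid whose unit is its only invertible
    element (axiom [unitm]), i.e. a positive commutative monoid. It is written
    multiplicatively ([mmul] for +, [mone] for 0), and it is the exponent monoid
    of the semigroup ring [{malg K[H]}], in which [<< h >>] is t^h. *)

Section AffineSemigroup.
Variable H : conomType.

Definition mpow (x : H) (n : nat) : H := iter n (mmul x) (mone : H).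

Definition generates (A : {fset H}) : Prop :=
  forall h : H, exists2 s : seq H,
    {subset s <= A} & h = \big[mmul/(mone : H)]_(a <- s) a.

Definition cancellative : Prop :=
  forall x y z : H, mmul x y = mmul x z -> y = z.

Definition torsion_free : Prop :=
  forall (n : nat) (x y : H), (0 < n)%N -> mpow x n = mpow y n -> x = y.

Record affine_semigroup : Prop := AffineSemigroup {
  affine_fg : exists A : {fset H}, generates A;
  affine_cancellative : cancellative;
  affine_torsion_free : torsion_free
}.

End AffineSemigroup.

(** QH = Q (x) ZH is presented by generators << h >>, h in H, and relations
    << x y >> = << x >> + << y >>: it is the quotient of the free vector space
    [{malg rat[H]}] by the span of those relations. *)

Section RationalSpan.
Variable H : conomType.

Definition add_rel (x y : H) : {malg rat[H]} :=
  << mmul x y >> - << x >> - << y >>.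

Definition add_rels : {pred {malg rat[H]}} := fun f =>
  `[< exists s : seq (rat * (H * H)),
        f = \sum_(t <- s) t.1 *: add_rel t.2.1 t.2.2 >].

Lemma add_rels_scale a f : f \in add_rels -> a *: f \in add_rels.
Proof.
move=> /asboolP[s ->]; apply/asboolP.
exists [seq (a * t.1, t.2) | t <- s]; rewrite big_map scaler_sumr.
by apply: eq_bigr => t _; rewrite /= scalerA.
Qed.

Lemma add_rels_zmod_closed : zmod_closed add_rels.
Proof.
split=> [|f g fJ gJ]; first by apply/asboolP; exists [::]; rewrite big_nil.
have /asboolP[s2 Eg] := add_rels_scale (-1) gJ; case/asboolP: fJ => s1 ->.
by apply/asboolP; exists (s1 ++ s2); rewrite big_cat /= -Eg scaleN1r.
Qed.

HB.instance Definition _ :=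
  GRing.isZmodClosed.Build {malg rat[H]} add_rels add_rels_zmod_closed.

Definition QH : Type := Quotient.quot add_rels.
HB.instance Definition _ := GRing.Zmodule.on QH.
HB.instance Definition _ := EqQuotient.on QH.

Lemma QH_eqP (f g : {malg rat[H]}) :
  reflect (\pi_QH f = \pi_QH g) (f - g \in add_rels).
Proof. by rewrite Quotient.idealrBE; apply: (iffP eqP) . Qed.

Lemma QH_ind (P : QH -> Prop) : (forall f, P (\pi_QH f)) -> forall v, P v.
Proof. by move=> Ppi v; rewrite -[v]reprK. Qed.

Definition QH_scale (a : rat) (v : QH) : QH := \pi_QH (a *: repr v).

Lemma QH_scaleE a f : QH_scale a (\pi_QH f) = \pi_QH (a *: f).
Proof.
apply/QH_eqP; rewrite -scalerBr; apply: add_rels_scale.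
by apply/QH_eqP; rewrite reprK.
Qed.

Lemma QH_scaleA a b v : QH_scale a (QH_scale b v) = QH_scale (a * b) v.
Proof. by elim/QH_ind: v => f; rewrite !QH_scaleE scalerA. Qed.

Lemma QH_scale1 : left_id 1 QH_scale.
Proof. by elim/QH_ind=> f; rewrite QH_scaleE scale1r. Qed.

Lemma QH_piD f g : \pi_QH (f + g) = \pi_QH f + \pi_QH g.
Proof. by rewrite !piE. Qed.

Lemma QH_scaleDr : right_distributive QH_scale +%R.
Proof.
move=> a; elim/QH_ind=> f; elim/QH_ind=> g.
by rewrite -QH_piD !QH_scaleE scalerDr QH_piD.
Qed.

Lemma QH_scaleDl v : {morph QH_scale^~ v : a b / a + b}.
Proof. by elim/QH_ind: v => f a b; rewrite !QH_scaleE scalerDl QH_piD. Qed.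

HB.instance Definition _ := GRing.Zmodule_isLmodule.Build rat QH
  QH_scaleA QH_scale1 QH_scaleDr QH_scaleDl.

Definition toQH (h : H) : QH := \pi_QH << h >>.

End RationalSpan.

Section Convexity.
Variable V : lmodType rat.
Implicit Types (S P : set V) (l : {scalar V}).

Definition convex_hull S : set V := [set x | exists n (p : 'I_n -> V)
    (c : 'I_n -> rat), [/\ forall i, S (p i), forall i, 0 <= c i,
    \sum_i c i = 1 & x = \sum_i c i *: p i]].

Definition linearly_independent n (p : 'I_n -> V) : Prop :=
  forall c : 'I_n -> rat, \sum_i c i *: p i = 0 -> forall i, c i = 0.

Definition affinely_independent n (p : 'I_n -> V) : Prop :=
  forall c : 'I_n -> rat,
    \sum_i c i = 0 -> \sum_i c i *: p i = 0 -> forall i, c i = 0.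

Definition rank_is (r : nat) : Prop :=
  (exists p : 'I_r -> V, linearly_independent p) /\
  (forall n (p : 'I_n -> V), linearly_independent p -> (n <= r)%N).

(** [aff_size_is S n]: the affine span of [S] has dimension [n - 1] (with
    dimension -1 for the empty set). *)
Definition aff_size_is S (n : nat) : Prop :=
  (exists p : 'I_n -> V, (forall i, S (p i)) /\ affinely_independent p) /\
  (forall m (p : 'I_m -> V), (forall i, S (p i)) ->
     affinely_independent p -> (m <= n)%N).

(** The whole polytope ([l = 0]) and the empty set are faces. *)
Definition face P S : Prop := exists l (m : rat),
  (forall x, P x -> l x <= m) /\ S = [set x | P x /\ l x = m].

Definition is_max (D : set rat) (m : rat) : Prop :=
  D m /\ forall d, D d -> d <= m.

End Convexity.

Section NewtonDegree.
Variables (H : conomType) (A : {fset H}).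
Implicit Types (l : {scalar QH H}) (h : H).

Definition newton_polytope : set (QH H) :=
  convex_hull ([set v | exists2 a, a \in A & v = toQH a] `|` [set 0]).

(** [newton_facet S]: [S] is an (r-1)-dimensional face of the polytope, r the
    rank of ZH, that does not contain 0. *)
Definition newton_facet (S : set (QH H)) : Prop :=
  exists2 r, rank_is (QH H) r &
    [/\ face newton_polytope S, aff_size_is S r & ~ S 0].

Definition facet_form (S : set (QH H)) l : Prop :=
  is_max (l @` newton_polytope) 1 /\
  [set x | l x = 1] `&` newton_polytope = S.

Definition newton_values h : set rat :=
  [set d | exists S l, [/\ newton_facet S, facet_form S l & d = l (toQH h)]].

(** The maximum is attained as soon as some facet has a form ([newton_degP]). If
    ZH = 0 none has, and by convention the only element of H has degree 0. *)
Definition newton_deg h : rat := xget 0 (is_max (newton_values h)).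

Lemma newton_polytope0 : newton_polytope 0.
Proof.
exists 1%N, (fun=> 0), (fun=> 1); split=> // [i||]; first by right.
  by rewrite big_ord1.
by rewrite big_ord1 scaler0.
Qed.

Lemma newton_polytopeA a : a \in A -> newton_polytope (toQH a).
Proof.
move=> aA; exists 1%N, (fun=> toQH a), (fun=> 1); split=> // [i||].
- by left; exists a.
- by rewrite big_ord1.
- by rewrite big_ord1 scale1r.
Qed.

Lemma facet_form_le l S x : facet_form S l -> newton_polytope x -> l x <= 1.
Proof. by case=> [[_ lle1] _] Px; apply: lle1; exists x. Qed.

Lemma facet_form_eq1 S S' l l' x :
    facet_form S l -> facet_form S' l' ->
    (forall a, a \in A -> l (toQH a) = 1 -> l' (toQH a) = 1) ->
  newton_polytope x -> l x = 1 -> l' x = 1.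
Proof.
move=> Fl Fl' ll' [n [p [c [Sp c0 c1 ->]]]] lx1.
have pP i : newton_polytope (p i).
  case: (Sp i) => [[a aA ->]|->]; first exact: newton_polytopeA.
  exact: newton_polytope0.
have z0 : \sum_i c i * (1 - l (p i)) = 0.
  under eq_bigr do rewrite mulrBr mulr1.
  rewrite sumrB c1 -lx1 linear_sum /=.
  by under eq_bigr do rewrite linearZ /=; rewrite subrr.
have /psumr_eq0P z : forall i, true -> 0 <= c i * (1 - l (p i)).
  by move=> i _; rewrite mulr_ge0 ?c0 // subr_ge0 (facet_form_le Fl).
rewrite linear_sum /= -[RHS]c1; apply: eq_bigr => i _; rewrite linearZ /=.
have /eqP := z z0 i isT; rewrite mulf_eq0 subr_eq0 => /orP[/eqP->|/eqP E1].
  by rewrite mul0r.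
case: (Sp i) => [[a aA Ea]|E0]; last first.
  by move/eqP: E1; rewrite E0 linear0 oner_eq0.
by rewrite Ea ll' ?mulr1 // -Ea.
Qed.

Lemma facet_form_inj S S' l l' :
    newton_facet S -> facet_form S l -> facet_form S' l' ->
    (forall a, a \in A -> l (toQH a) = 1 -> l' (toQH a) = 1) ->
  l =1 l'.
Proof.
move=> [r [_ maxr] [_ [[p [Sp ap]] _] _]] Fl Fl' ll' x.
have pP i : newton_polytope (p i) /\ l (p i) = 1.
  by have := Sp i; rewrite -Fl.2 => -[].
have lp' i : l' (p i) = 1 by apply: (facet_form_eq1 Fl Fl' ll'); case: (pP i).
have indep c : \sum_i c i *: p i = 0 -> forall i, c i = 0.
  move=> c0; apply: (ap c _ c0); have := congr1 l c0.
  rewrite linear_sum linear0 /= => E; rewrite -[RHS]E.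
  by apply: eq_bigr => i _; rewrite linearZ /= (pP i).2 mulr1.
pose q (i : 'I_r.+1) := if unlift ord0 i is Some j then p j else x.
have /existsNP[c /not_implyP[c0 /existsNP[i ci]]] :
    ~ linearly_independent q by move/maxr; rewrite ltnn.
have E : c ord0 *: x + \sum_j c (lift ord0 j) *: p j = 0.
  rewrite -[RHS]c0 [RHS]big_ord_recl /q unlift_none; congr (_ + _).
  by refine (eq_bigr _ _) => j _; rewrite liftK.
have cn0 : c ord0 != 0.
  apply/eqP => c00; apply: ci; case: (unliftP ord0 i) => [j ->|-> //].
  by apply: (indep (fun j => c (lift ord0 j))); rewrite c00 scale0r add0r in E.
apply: (mulfI cn0); apply: (addIr (\sum_j c (lift ord0 j))).
have val m : (forall j, (m : {scalar QH H}) (p j) = 1) ->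
    c ord0 * m x + \sum_j c (lift ord0 j) = 0.
  move=> mp; rewrite -[RHS](linear0 m) -E linearD linearZ linear_sum /=.
  by congr (_ + _); apply: eq_bigr => j _; rewrite linearZ /= mp mulr1.
by rewrite !val // => j; case: (pP j).
Qed.

Lemma newton_degP h : newton_values h !=set0 ->
  is_max (newton_values h) (newton_deg h).
Proof.
move=> [d0 [S0 [l0 [N0 F0 _]]]].
pose P (m : {ffun A -> bool}) (l : {scalar QH H}) :=
  exists S, [/\ newton_facet S, facet_form S l &
    forall a : A, m a = (l (toQH (val a)) == 1)].
pose f m := if pselect (exists l, P m l) is left e then sval (cid e) else l0.
have fP l S : newton_facet S -> facet_form S l ->
    exists m, P m (f m) /\ f m =1 l.
  move=> N F; pose m := [ffun a : A => l (toQH (val a)) == 1].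
  have Pm : P m l by exists S; split=> // a; rewrite ffunE.
  exists m; have Pf : P m (f m).
    by rewrite /f; case: pselect => [e|[]]; [apply: svalP|exists l].
  split=> //; case: Pf => S' [N' F' mS']; apply: (facet_form_inj N' F' F).
  move=> a aA /eqP; have := mS' [` aA]%fset; rewrite ffunE /= => <-.
  by move/eqP.
have [m0 [Pm0 _]] := fP _ _ N0 F0.
pose g m := f m (toQH h).
pose Pf m := `[< P m (f m) >].
have Pm0b : Pf m0 by apply/asboolP.
have [m /asboolP[S [N F _]] mmax] := arg_maxP g Pm0b.
apply: (@xgetPex _ 0 (is_max (newton_values h))); exists (g m).
split; first by exists S, (f m).
move=> _ [S' [l [N' F' ->]]]; have [m' [Pm' <-]] := fP _ _ N' F'.
by apply: mmax; apply/asboolP.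
Qed.

Lemma newton_deg_unit : newton_deg mone = 0.
Proof.
have toQH1 : toQH (mone : H) = 0.
  have E : toQH (mone : H) = toQH mone + toQH mone.
    rewrite -QH_piD; apply/QH_eqP/asboolP; exists [:: (1, (mone, mone))].
    by rewrite big_seq1 scale1r /add_rel /= mulm1 opprD addrA.
  by apply: (addIr (toQH mone)); rewrite -E add0r.
rewrite /newton_deg; case: xgetP => // d _ [[S [l [_ _ ->]]] _].
by rewrite toQH1 linear0.
Qed.

Lemma newton_degM h h' :
  newton_deg (mmul h h') <= newton_deg h + newton_deg h'.
Proof.
have toQHM : toQH (mmul h h') = toQH h + toQH h'.
  rewrite -QH_piD; apply/QH_eqP/asboolP; exists [:: (1, (h, h'))].
  by rewrite big_seq1 scale1r /add_rel /= opprD addrA.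
have [[d [S [l [N F dE]]]]|/set0P/negP/negbNE/eqP no] :=
    pselect (newton_values (mmul h h') !=set0); last first.
  have deg0 k : newton_deg k = 0.
    rewrite /newton_deg; case: xgetP => // d _ [[S [l [N F dE]]] _].
    have : newton_values (mmul h h') (l (toQH (mmul h h'))) by exists S, l.
    by rewrite no.
  by rewrite !deg0 addr0.
have ne k : newton_values k !=set0 by exists (l (toQH k)), S, l.
have [[S' [l' [N' F' ->]]] _] := newton_degP (ne (mmul h h')).
rewrite toQHM linearD lerD //.
  by apply: (newton_degP (ne h)).2; exists S', l'.
by apply: (newton_degP (ne h')).2; exists S', l'.
Qed.

End NewtonDegree.

(** The last field makes the associated graded ring nontrivial, as required
    by [comNzRingType]. *)
Record filtration (R : comNzRingType) := Filtration {
  fil :> rat -> {pred R};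
  fil_zmod_closed : forall k, zmod_closed (fil k);
  fil_homo : forall j k, j <= k -> {subset fil j <= fil k};
  fil_mul : forall j k x y, x \in fil j -> y \in fil k -> x * y \in fil (j + k);
  fil_one : 1 \in fil 0;
  fil_neg : forall k, k < 0 -> 1 \notin fil k
}.

(** The group ring R[T^Q], i.e. the direct sum of the [R T^k], k in Q.
    ([rat] is not a [monomType], so the ring structure that [{malg R[K]}] has
    for a [monomType] [K] is not available.) *)

Definition qgroup_ring (R : comNzRingType) : Type := {malg R[rat]}.

Section QGroupRing.
Variable R : comNzRingType.
Local Notation S := (qgroup_ring R).
Implicit Types (x y z : S) (d : {fset rat}).

HB.instance Definition _ := GRing.Zmodule.on S.

Definition qgr_one : S := << 1 *g 0 : rat >>.

Definition qgr_mul x y : S :=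
  \sum_(i <- msupp x) \sum_(j <- msupp y) << x@_i * y@_j *g i + j >>.

Lemma qgr_mulw d d' x y : (msupp x `<=` d)%fset -> (msupp y `<=` d')%fset ->
  qgr_mul x y = \sum_(i <- d) \sum_(j <- d') << x@_i * y@_j *g i + j >>.
Proof.
move=> led led'; rewrite /qgr_mul (big_fset_incl _ led) /=.
  apply: eq_bigr => i _; apply: big_fset_incl => // j _ /mcoeff_outdom ->.
  by rewrite mulr0 monalgU0.
move=> i _ /mcoeff_outdom xi.
by rewrite big1 // => j _; rewrite xi mul0r monalgU0.
Qed.

Lemma qgr_mulC : commutative qgr_mul.
Proof.
move=> x y; rewrite /qgr_mul exchange_big /=; apply: eq_bigr => i _.
by apply: eq_bigr => j _; rewrite mulrC addrC.
Qed.

Lemma qgr_mulDl : left_distributive qgr_mul +%R.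
Proof.
move=> x y z; have le_z := fsubset_refl (msupp z).
rewrite (qgr_mulw (msuppD_le x y) le_z).
rewrite (qgr_mulw (fsubsetUl _ (msupp y)) le_z).
rewrite (qgr_mulw (fsubsetUr (msupp x) _) le_z) -big_split /=.
apply: eq_bigr => i _; rewrite -big_split /=; apply: eq_bigr => j _.
by rewrite mcoeffD mulrDl monalgUD.
Qed.

Lemma qgr_mul0 : left_zero 0 qgr_mul.
Proof. by move=> x; rewrite /qgr_mul msupp0 big_seq_fset0. Qed.

Lemma qgr_mulr0 : right_zero 0 qgr_mul.
Proof. by move=> x; rewrite qgr_mulC qgr_mul0. Qed.

Lemma qgr_mulUU a b (i j : rat) :
  qgr_mul << a *g i >> << b *g j >> = << a * b *g i + j >>.
Proof. by rewrite (qgr_mulw msuppU_le msuppU_le) !big_seq_fset1 !mcoeffUU. Qed.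

Lemma qgr_mulDr : right_distributive qgr_mul +%R.
Proof. by move=> x y z; rewrite !(qgr_mulC x) qgr_mulDl. Qed.

Lemma qgr_ind (P : S -> Prop) : P 0 -> (forall x y, P x -> P y -> P (x + y)) ->
  (forall a i, P << a *g i >>) -> forall x, P x.
Proof. by move=> P0 PD PU x; rewrite [x]monalgE; apply: big_ind. Qed.

Lemma qgr_mulA : associative qgr_mul.
Proof.
move=> x y z; elim/qgr_ind: x => [|x x' Ex Ex'|a i].
- by rewrite !qgr_mul0.
- by rewrite !qgr_mulDl Ex Ex'.
elim/qgr_ind: y => [|y y' Ey Ey'|b j].
- by rewrite !(qgr_mul0, qgr_mulr0).
- by rewrite !(qgr_mulDl, qgr_mulDr) Ey Ey'.
elim/qgr_ind: z => [|z z' Ez Ez'|c k].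
- by rewrite !qgr_mulr0.
- by rewrite !qgr_mulDr Ez Ez'.
by rewrite !qgr_mulUU mulrA addrA.
Qed.

Lemma qgr_mul1 : left_id qgr_one qgr_mul.
Proof.
elim/qgr_ind=> [|x y Ex Ey|a i]; first by rewrite qgr_mulr0.
  by rewrite qgr_mulDr Ex Ey.
by rewrite qgr_mulUU mul1r add0r.
Qed.

Lemma qgr_one_neq0 : qgr_one != 0.
Proof. by rewrite monalgU_eq0 oner_eq0. Qed.

HB.instance Definition _ := GRing.Zmodule_isComNzRing.Build S
  qgr_mulA qgr_mulC qgr_mul1 qgr_mulDl qgr_one_neq0.

End QGroupRing.

(** The associated graded ring, the direct sum of the N_k / N_{<k}, is built as
    the quotient of the Rees ring, the direct sum of the N_k T^k in R[T^Q], by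
    the ideal that is the direct sum of the N_{<k} T^k. *)

Section AssociatedGraded.
Variables (R : comNzRingType) (N : filtration R).

Definition fil_lt (k : rat) : {pred R} :=
  fun x => `[< exists2 j, j < k & x \in N j >].

Lemma fil_lt_zmod_closed k : zmod_closed (fil_lt k).
Proof.
split=> [|x y /asboolP[i ik xi] /asboolP[j jk yj]]; apply/asboolP.
  by exists (k - 1); [rewrite gtrBl | case: (fil_zmod_closed N (k - 1))].
exists (Num.max i j); first by rewrite gt_max ik jk.
have [_] := fil_zmod_closed N (Num.max i j); apply.
  by apply: fil_homo xi; rewrite le_max lexx.
by apply: fil_homo yj; rewrite le_max lexx orbT.
Qed.

Definition rees_pred : {pred qgroup_ring R} :=
  fun x => `[< forall k : rat, x@_k \in N k >].

Lemma coef_mul_mem (x y : qgroup_ring R) (P Q : rat -> {pred R}) :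
    (forall k, zmod_closed (Q k)) -> (forall i, y@_i \in N i) ->
    (forall i, x@_i \in P i) ->
    (forall i j a b, a \in P i -> b \in N j -> a * b \in Q (i + j)) ->
  forall k, (x * y)@_k \in Q k.
Proof.
move=> Qz yN xP PNQ k; rewrite [x * y]/(qgr_mul x y).
have Q0 : 0 \in Q k by case: (Qz k).
have QD a b : a \in Q k -> b \in Q k -> a + b \in Q k.
  have [_ QB] := Qz k => aQ bQ.
  by rewrite -[b]opprK -[- b]sub0r QB // QB.
rewrite raddf_sum /=; elim/big_ind: _ => // i _.
rewrite raddf_sum /=; elim/big_ind: _ => // j _.
by rewrite mcoeffU; case: eqP => [<-|_]; rewrite ?mulr0n // mulr1n PNQ.
Qed.

Lemma rees_subring_closed : subring_closed rees_pred.
Proof.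
split=> [|x y /asboolP xN /asboolP yN|x y /asboolP xN /asboolP yN].
- apply/asboolP => k; rewrite [1]/(qgr_one R) mcoeffU.
  case: eqP => [<-|_]; first exact: fil_one.
  by case: (fil_zmod_closed N k).
- by apply/asboolP => k; rewrite mcoeffB; have [_] := fil_zmod_closed N k; apply.
- apply/asboolP; apply: (coef_mul_mem (fil_zmod_closed N) yN xN).
  exact: fil_mul.
Qed.

HB.instance Definition _ :=
  GRing.isSubringClosed.Build _ rees_pred rees_subring_closed.

Record rees := Rees { rees_val : qgroup_ring R; _ : rees_val \in rees_pred }.

HB.instance Definition _ := [isSub for rees_val].
HB.instance Definition _ := [Choice of rees by <:].
HB.instance Definition _ := [SubChoice_isSubComNzRing of rees by <:].

Definition rees_lt : {pred rees} :=
  fun x => `[< forall k : rat, (\val x)@_k \in fil_lt k >].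

Lemma rees_lt_idealr_closed : idealr_closed rees_lt.
Proof.
split=> [||a x y /asboolP xN /asboolP yN].
- by apply/asboolP => k; rewrite rmorph0 mcoeff0; case: (fil_lt_zmod_closed k).
- apply/asboolP => /(_ 0); rewrite rmorph1 [1]/(qgr_one R) mcoeffUU.
  by case/asboolP => j /(fil_neg N)/negP.
- have aN : forall k, (\val a)@_k \in N k by apply/asboolP/(valP a).
  have axN k : (\val (a * x))@_k \in fil_lt k.
    rewrite rmorphM mulrC; apply: (coef_mul_mem fil_lt_zmod_closed aN xN).
    move=> i j b c /asboolP[i' lt_i bN] cN; apply/asboolP.
    by exists (i' + j); [rewrite ltrD2r | apply: fil_mul].
  have [f0 fB] : (forall k, 0 \in fil_lt k) /\
      (forall k, {in fil_lt k &, forall b c, b - c \in fil_lt k}).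
    by split=> k; case: (fil_lt_zmod_closed k).
  apply/asboolP => k; rewrite rmorphD mcoeffD -[X in _ + X]opprK.
  by apply: (fB k _ _ (axN k)); rewrite -sub0r; apply: (fB k).
Qed.

HB.instance Definition _ := isIdealr.Build rees rees_lt rees_lt_idealr_closed.

Definition assoc_graded : comNzRingType := {ideal_quot rees_lt}.

End AssociatedGraded.

Section NewtonFiltration.
Variables (K : fieldType) (H : conomType) (A : {fset H}).

Definition newton_fil (k : rat) : {pred {malg K[H]}} :=
  fun f => all (fun h => newton_deg A h <= k) (msupp f).

Lemma newton_filP k f :
  reflect (forall h, f@_h != 0 -> newton_deg A h <= k) (f \in newton_fil k).
Proof.
apply: (iffP allP) => /= fk h; first by rewrite mcoeff_neq0; apply: fk.
by rewrite -mcoeff_neq0; apply: fk.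
Qed.

Lemma newton_fil_zmod_closed k : zmod_closed (newton_fil k).
Proof.
split=> [|f g /newton_filP fk /newton_filP gk]; apply/newton_filP => h.
  by rewrite mcoeff0 eqxx.
rewrite mcoeffB; have [->|/fk //] := eqVneq f@_h 0.
by rewrite sub0r oppr_eq0; apply: gk.
Qed.

Lemma newton_fil_homo j k : j <= k -> {subset newton_fil j <= newton_fil k}.
Proof.
move=> jk f /newton_filP fj; apply/newton_filP => h /fj; move/le_trans; exact.
Qed.

Lemma newton_fil_mul j k f g : f \in newton_fil j -> g \in newton_fil k ->
  f * g \in newton_fil (j + k).
Proof.
move=> /allP fj /allP gk; apply/allP => _ /msuppM_le[h [h' [hf hg ->]]].
exact: le_trans (newton_degM A h h') (lerD (fj _ hf) (gk _ hg)).
Qed.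

Lemma newton_fil_one : 1 \in newton_fil 0.
Proof.
apply/newton_filP => h; rewrite mcoeff1.
by case: (eqVneq h mone) => [->|]; rewrite ?newton_deg_unit // eqxx.
Qed.

Lemma newton_fil_neg k : k < 0 -> 1 \notin newton_fil k.
Proof.
move=> k0; apply/newton_filP => /(_ mone).
by rewrite mcoeff1 eqxx newton_deg_unit oner_eq0 leNgt k0 => /(_ isT).
Qed.

Definition newton_filtration : filtration {malg K[H]} :=
  Filtration newton_fil_zmod_closed newton_fil_homo newton_fil_mul
    newton_fil_one newton_fil_neg.

Definition newton_graded_ring : comNzRingType :=
  assoc_graded newton_filtration.

End NewtonFiltration.

(** A Noetherian ring is Cohen-Macaulay if depth(M, R) = codim M for every
    maximal ideal M (Eisenbud, Commutative Algebra, Section 18.2): depth(M, R)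
    is the maximal length of a regular sequence in M, and codim M = dim R_M is
    the maximal length of a chain of primes descending from M. *)

Section CohenMacaulay.
Variable R : comNzRingType.
Implicit Types (I M P : {pred R}) (s : seq R).

Definition ideal_gen s : {pred R} := fun x =>
  `[< exists c : 'I_(size s) -> R, x = \sum_(i < size s) c i * s`_i >].

Definition noetherian : Prop := forall I, idealr_closed I ->
  exists s, I =i ideal_gen s.

Definition maximal_ideal M : Prop := idealr_closed M /\
  forall I, idealr_closed I -> {subset M <= I} -> I =i M.

Definition prime_ideal P : Prop := idealr_closed P /\ prime_idealr_closed P.

Definition regular_sequence s : Prop := 1 \notin ideal_gen s /\
  forall i x, (i < size s)%N ->
    s`_i * x \in ideal_gen (take i s) -> x \in ideal_gen (take i s).

Definition depth_is I (n : nat) : Prop :=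
  (exists s, [/\ regular_sequence s, {subset s <= I} & size s = n]) /\
  (forall s, regular_sequence s -> {subset s <= I} -> (size s <= n)%N).

Definition prime_chain P (n : nat) (C : nat -> {pred R}) : Prop :=
  [/\ forall i, (i <= n)%N -> prime_ideal (C i),
      forall i, (i < n)%N ->
        {subset C i <= C i.+1} /\ ~ {subset C i.+1 <= C i}
    & C n =i P].

Definition codim_is P (n : nat) : Prop :=
  (exists C, prime_chain P n C) /\
  (forall m C, prime_chain P m C -> (m <= n)%N).

Definition cohen_macaulay : Prop := noetherian /\
  forall M, maximal_ideal M -> exists2 n, depth_is M n & codim_is M n.

End CohenMacaulay.

(* Main.v *)
From HB Require Import structures.
Require Import Defs.
From mathcomp Require Import all_boot all_order all_algebra.
From mathcomp Require Import finmap monalg.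
From mathcomp Require Import boolp classical_sets.

(** Since [H] is positive, Stiemke's lemma gives a linear form [L] on QH that is
    positive on the generators [a_i <> 0]. Scale [L] so that every [1 / L a_i] is
    an integer [k_i], and let [A] consist of the generators and of the multiples
    [k_i a_i]. These multiples lie on the hyperplane [L = 1] and every other
    element of [A] lies below it, so the polytope has a single facet off the
    origin and the Newton degree is [L] itself. The degree is then additive, the
    Newton filtration comes from a grading of K[H], and the associated graded
    ring is isomorphic to K[H]. *)

Set Implicit Arguments.
Unset Strict Implicit.
Unset Printing Implicit Defensive.

Import Order.TTheory GRing.Theory Num.Theory.
Local Open Scope ring_scope.
Local Open Scope quotient_scope.

(** * Linear inequalities over an ordered field *)

(** Among the matrices whose row space lies in [P], one of maximal rank captures all of [P], since
    adjoining a further row of [P] cannot raise the rank. Its cokernel is [C]. *)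
Lemma subspace_kernel (F : fieldType) n (P : 'rV[F]_n -> Prop) :
    P 0 -> (forall a u v, P u -> P v -> P (a *: u + v)) ->
  exists C : 'M[F]_n, forall u, P u <-> u *m C = 0.
Proof.
move=> P0 PD.
pose good r := `[< exists2 M : 'M[F]_n,
  forall u : 'rV_n, (u <= M)%MS -> P u & \rank M = r >].
have good0 : exists r, good r.
  exists 0%N; apply/asboolP; exists 0; last by rewrite mxrank0.
  by move=> u; rewrite submx0 => /eqP->.
have goodn r : good r -> (r <= n)%N by case/asboolP=> M _ <-; apply: rank_leq_row.
case: (ex_maxnP good0 goodn) => r /asboolP[M PM rM] maxM.
exists (cokermx M) => u; split=> [Pu|/eqP uM]; last by apply/PM; rewrite submxE.
apply/eqP; rewrite -submxE.
suff: (M + u <= M)%MS by apply: submx_trans; apply: addsmxSr.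
rewrite -(geq_leqif (mxrank_leqif_sup (addsmxSl M u))) rM; apply: maxM.
apply/asboolP; exists (M + u)%MS => // _ /sub_addsmxP[[x y] ->] /=.
rewrite [y]mx11_scalar mul_scalar_mx addrC; apply: PD => //.
by apply: PM; apply: submxMl.
Qed.

Section Farkas.
Variables (F : realFieldType) (n m : nat) (C : 'M[F]_(n, m)).

(* Minty's induction on the set [s] of sign constraints: each step turns the
   constraint [f] either into an equality (adding row f to [Z]) or into no
   constraint at all, and a pair of bad outcomes is contradictory. *)
Lemma farkas (s : seq 'I_n) (e : 'rV[F]_m) (Z : 'M[F]_m) :
  (exists l : 'cV[F]_m, [/\ Z *m l = 0, forall i, i \in s -> 0 <= (C *m l) i 0
     & 0 < (e *m l) 0 0]) \/
  (exists c : 'rV[F]_n, [/\ forall i, 0 <= c 0 i,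
     forall i, i \notin s -> c 0 i = 0 & ((e + c *m C)%R <= Z)%MS]).
Proof.
elim: s e Z => [|f s IHs] e Z.
  have [eZ|] := boolP (e <= Z)%MS.
    right; exists 0; split=> [i|i _|]; rewrite ?mxE //.
    by rewrite mul0mx addr0.
  rewrite submxE => /rV0Pn[j ej]; left.
  (* Columns of [cokermx Z] are killed by [Z]; scaling column [j] by its own value [t] at [e] makes
     the new value a nonzero square. *)
  pose t := (e *m cokermx Z) 0 j; exists (t *: col j (cokermx Z)).
  have colE k (A : 'M[F]_(k, m)) :
      A *m (t *: col j (cokermx Z)) = t *: col j (A *m cokermx Z).
    by rewrite -scalemxAr !colE mulmxA.
  split=> //; first by rewrite colE mulmx_coker col0 scaler0.
  rewrite colE !mxE; have -> : \sum_j0 e 0 j0 * cokermx Z j0 j = t by rewrite /t mxE.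
  by rewrite -expr2 exprn_even_gt0 //= ej.
have [[l [Zl sl el]]|[c [c0 cs cZ]]] := IHs e (Z + row f C)%MS.
  have Wl p (W : 'M[F]_(p, m)) : (W <= Z + row f C)%MS -> W *m l = 0.
    by move/(submxMr l); rewrite Zl => /submx0null.
  have fl := Wl _ _ (addsmxSr Z (row f C)).
  left; exists l; split=> //; first exact/Wl/addsmxSl.
  move=> i; rewrite inE => /predU1P[->|/sl //].
  by move/matrixP/(_ 0 0): fl; rewrite -row_mul !mxE => ->.
(* Modulo row [f] the certificate reads [e + c *m C = x *m Z + t *: row f C]; for [t <= 0] the last
   term can be moved into [c]. *)
have [[x y] /= E] := sub_addsmxP cZ.
rewrite [y]mx11_scalar mul_scalar_mx in E; set t := y 0 0 in E.
have rowfE : row f C = delta_mx 0 f *m C by rewrite rowE.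
have [t0|t0] := leP t 0.
  right; exists (c - t *: delta_mx 0 f); split=> [i|i|].
  - rewrite !mxE /= subr_ge0 (le_trans _ (c0 i)) // mulr_le0_ge0 //.
  - by rewrite inE negb_or !mxE /= => /andP[/negPf-> /cs->]; rewrite mulr0 subr0.
  - by rewrite mulmxBl addrA E -scalemxAl -rowfE addrK submxMl.
(* For [t > 0] the constraint [f] is dropped. At a solution [l] violating it, the left side of [E]
   would be positive and the right side negative. *)
have [[l [Zl sl el]]|[d [d0 ds dZ]]] := IHs e Z; last first.
  right; exists d; split=> // i.
  by rewrite inE negb_or => /andP[_ /ds].
have [fl|fl] := leP 0 ((C *m l) f 0).
  left; exists l; split=> // i.
  by rewrite inE => /predU1P[->|/sl].
have := congr1 (fun v : 'rV_m => (v *m l) 0 0) E.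
rewrite /= !mulmxDl -!mulmxA Zl mulmx0 add0r -scalemxAl -row_mul.
rewrite mxE [RHS]mxE [X in _ = _ * X]mxE => E'.
have : 0 < t * (C *m l) f 0.
  rewrite -E' ltr_pwDl // mxE sumr_ge0 // => i _.
  by have [/sl h|/cs->] := boolP (i \in s); [apply: mulr_ge0|rewrite mul0r].
by rewrite pmulr_rgt0 // ltNge ltW.
Qed.

(** For each row [i], Farkas gives a vector nonnegative on all rows and positive on row [i]: the
    alternative is a nonnegative combination killed by [C] whose coefficient at [i] is at least 1.
    The sum of these vectors is positive everywhere. *)
Lemma stiemke :
    (forall c : 'rV[F]_n, (forall i, 0 <= c 0 i) -> c *m C = 0 -> c = 0) ->
  exists l : 'cV[F]_m, forall i, 0 < (C *m l) i 0.
Proof.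
move=> pointed.
have /fin_all_exists[l lP] (i : 'I_n) :
    exists l : 'cV[F]_m, (forall j, 0 <= (C *m l) j 0) /\ 0 < (C *m l) i 0.
  have [[l [_ l0 li]]|[c [c0 _]]] := farkas (enum 'I_n) (row i C) 0.
    exists l; split=> [j|]; first by rewrite l0 ?mem_enum.
    by rewrite -row_mul mxE in li.
  rewrite submx0 rowE -mulmxDl => /eqP /pointed E.
  have /E/matrixP/(_ 0 i) : forall j, 0 <= (delta_mx 0 i + c) 0 j.
    by move=> j; rewrite !mxE addr_ge0.
  by rewrite !mxE !eqxx => /eqP; rewrite gt_eqF // ltr_pwDl.
exists (\sum_i l i) => j; rewrite mulmx_sumr summxE (bigD1 j) //=.
by rewrite ltr_pwDl ?(lP j).2 // sumr_ge0 // => i _; case: (lP i).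
Qed.

End Farkas.

(** A matrix [C] with the same kernel as the coordinate map identifies [V] with its row space.
    Independence becomes row freeness of [M *m C], and a maximal free set of rows of [C] selects a
    basis among the [b i]. *)
Lemma spanning_rank (V : lmodType rat) n (b : 'I_n -> V) :
    (forall x, exists c : 'rV[rat]_n, x = \sum_i c 0 i *: b i) ->
  exists r (f : 'I_r -> 'I_n), linearly_independent (b \o f) /\ rank_is V r.
Proof.
move=> span; pose K (c : 'rV[rat]_n) := \sum_i c 0 i *: b i = 0.
have [||C KC] := @subspace_kernel _ _ K.
- by rewrite /K big1 // => i _; rewrite mxE scale0r.
- move=> a u v Ku Kv; rewrite /K.
  under eq_bigr do rewrite !mxE scalerDl -scalerA.
  by rewrite big_split /= -scaler_sumr Ku Kv scaler0 addr0.
have sumE m (d : 'I_m -> rat) (M : 'M[rat]_(m, n)) :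
    \sum_j d j *: (\sum_i M j i *: b i)
      = \sum_i ((\row_j d j) *m M) 0 i *: b i.
  under eq_bigr do rewrite scaler_sumr.
  rewrite exchange_big /=; apply: eq_bigr => i _.
  rewrite mxE scaler_suml; apply: eq_bigr => j _.
  by rewrite mxE scalerA.
have indepP m (M : 'M[rat]_(m, n)) :
    linearly_independent (fun j => \sum_i M j i *: b i) <-> row_free (M *m C).
  split=> [ind|/row_freeP[N MN] d].
    rewrite -kermx_eq0; apply/eqP/row_matrixP => i; rewrite row0.
    set u := row i _; have uM : u *m M *m C = 0.
      by rewrite -mulmxA -row_mul mulmx_ker row0.
    apply/rowP => j; rewrite [RHS]mxE; apply: (ind (fun j => u 0 j)).
    rewrite sumE; have -> : \row_j u 0 j = u by apply/rowP=> k; rewrite mxE.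
    by apply/KC.
  rewrite sumE => /KC E i.
  have /rowP/(_ i) : (\row_j d j) *m (M *m C) *m N = 0.
    by rewrite mulmxA E mul0mx.
  by rewrite -mulmxA MN mulmx1 !mxE.
exists (\rank C), (maxrankfun C).
have ind : linearly_independent (b \o maxrankfun C).
  have := (indepP _ (rowsub (maxrankfun C) 1%:M)).2.
  rewrite mul_rowsub_mx mul1mx maxrowsub_free => /(_ isT) ind c c0.
  apply: ind; rewrite -[RHS]c0; apply: eq_bigr => j _; congr (_ *: _).
  rewrite (bigD1 (maxrankfun C j)) //= !mxE eqxx scale1r big1 ?addr0 // => i.
  by rewrite !mxE eq_sym => /negPf->; rewrite scale0r.
split=> //; split; first by exists (b \o maxrankfun C).
move=> m p indp; have /fin_all_exists[M pM] j := span (p j).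
have : linearly_independent
    (fun j => \sum_i (\matrix_(j', i') M j' 0 i') j i *: b i).
  move=> c c0; apply: indp; rewrite -[RHS]c0; apply: eq_bigr => j _.
  by rewrite pM; congr (_ *: _); apply: eq_bigr => i _; rewrite mxE.
by move/indepP/eqP <-; apply: mxrankM_maxr.
Qed.

(** * Additive forms on a positive semigroup *)

Lemma mpowD (H : conomType) (x : H) m n :
  mpow x (m + n) = mmul (mpow x m) (mpow x n).
Proof.
elim: m => [|m IHm]; first by rewrite [mpow x 0]/mone mul1m.
by rewrite addSn /mpow /= -!/(mpow x _) IHm mulmA.
Qed.

Section PowerProducts.
Variables (H : conomType) (n : nat) (a : 'I_n -> H).

Definition pow_prod (u : 'I_n -> nat) : H :=
  \big[mmul/(mone : H)]_i mpow (a i) (u i).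

Lemma pow_prodD u v :
  pow_prod (fun i => u i + v i)%N = mmul (pow_prod u) (pow_prod v).
Proof. by rewrite -big_split; apply: eq_bigr => i _; apply: mpowD. Qed.

Lemma pow_prod0 : pow_prod (fun=> 0%N) = mone.
Proof. by rewrite /pow_prod big1. Qed.

Lemma pow_prod1 i : pow_prod (fun j => (j == i) : nat) = a i.
Proof.
rewrite /pow_prod (bigD1 i) //= eqxx /mpow /= mulm1 big1 ?mulm1 // => j.
by move/negPf->.
Qed.

Lemma eq_pow_prod u v : u =1 v -> pow_prod u = pow_prod v.
Proof. by move=> uv; apply: eq_bigr => i _; rewrite uv. Qed.

Lemma pow_prodM k u v : pow_prod u = pow_prod v ->
  pow_prod (fun i => k * u i)%N = pow_prod (fun i => k * v i)%N.
Proof.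
move=> uv; elim: k => [//|k IHk].
rewrite (@eq_pow_prod _ (fun i => u i + k * u i)%N) //.
by rewrite pow_prodD uv IHk -pow_prodD.
Qed.

(** Positivity enters here through [unitm]: a factor of a trivial product is trivial, and [a i] is a
    factor of each of its positive powers. *)
Lemma pow_prod_eq1 u : (forall i, a i <> mone) ->
  pow_prod u = mone -> forall i, u i = 0%N.
Proof.
move=> a1 + i; rewrite /pow_prod (bigD1 i) //= => /unitm[+ _].
by case: (u i) => // k; rewrite /mpow /= => /unitm[/a1].
Qed.

Hypothesis gen : forall h, exists u, h = pow_prod u.
Hypothesis canc : cancellative H.
Hypothesis a_neq1 : forall i, a i <> mone.

(* The rational span of the differences [u - v] with [a^u = a^v]. *)
Let relation (w : 'rV[rat]_n) : Prop := exists N u v, [/\ (0 < N)%N,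
  pow_prod u = pow_prod v & forall i, N%:R * w 0 i = (u i)%:R - (v i)%:R].

Let relation_scale c w : relation w -> relation (c *: w).
Proof.
move=> [N [u [v [N0 uv E]]]].
have dE : (`|denq c|%N)%:R = (denq c)%:~R :> rat.
  by rewrite -{2}(gez0_abs (ltW (denq_gt0 c))).
have cE : (`|denq c|%N)%:R * c = (numq c)%:~R.
  by rewrite dE -{2}[c]divq_num_den mulrC divfK // intr_eq0 denq_neq0.
have N'0 : (0 < N * `|denq c|)%N by rewrite muln_gt0 N0 absz_gt0 denq_neq0.
have E' i : (N * `|denq c|)%:R * (c *: w) 0 i =
    (numq c)%:~R * ((u i)%:R - (v i)%:R).
  by rewrite mxE -E -cE natrM -!mulrA; rewrite mulrCA; congr (_ * _); rewrite mulrCA.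
have absE i : (`|numq c| * u i)%:R = `|numq c|%:~R * (u i)%:R :> rat.
  by rewrite natrM natr_absz.
have absE' i : (`|numq c| * v i)%:R = `|numq c|%:~R * (v i)%:R :> rat.
  by rewrite natrM natr_absz.
have [c0|c0] := leP 0 (numq c).
  exists (N * `|denq c|)%N, (fun i => `|numq c| * u i)%N,
    (fun i => `|numq c| * v i)%N; split=> // [|i]; first exact: pow_prodM.
  by rewrite E' absE absE' ger0_norm // mulrBr.
(* A negative scalar exchanges the two sides of the relation. *)
exists (N * `|denq c|)%N, (fun i => `|numq c| * v i)%N,
  (fun i => `|numq c| * u i)%N; split=> // [|i]; first exact: pow_prodM.
by rewrite E' absE absE' ltr0_norm // mulrNz !mulNr mulrBr opprK addrC.
Qed.

Let relationD w w' : relation w -> relation w' -> relation (w + w').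
Proof.
move=> [N [u [v [N0 uv E]]]] [N' [u' [v' [N'0 uv' E']]]].
exists (N * N')%N, (fun i => N' * u i + N * u' i)%N,
  (fun i => N' * v i + N * v' i)%N; split=> [||i].
- by rewrite muln_gt0 N0.
- by rewrite !pow_prodD (pow_prodM N' uv) (pow_prodM N uv').
rewrite mxE !natrD !natrM mulrDr opprD addrACA -!mulrBr -E -E' !mulrA.
by rewrite (mulrC N'%:R).
Qed.

(** A nonnegative relation has [v <= u] entrywise; cancelling [pow_prod v] leaves a trivial product
    with exponents [u - v]. This is the pointedness that [stiemke] asks for. *)
Let relation_ge0 (c : 'rV[rat]_n) : (forall i, 0 <= c 0 i) -> relation c -> c = 0.
Proof.
move=> c0 [N [u [v [N0 uv E]]]].
have vu i : (v i <= u i)%N.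
  by rewrite -(ler_nat rat) -subr_ge0 -E mulr_ge0 ?ler0n.
have d0 : forall i, (u i - v i = 0)%N.
  apply: (pow_prod_eq1 a_neq1); apply: (canc (x := pow_prod v)).
  rewrite -pow_prodD mulm1 -uv; apply: eq_pow_prod => i.
  by rewrite subnKC.
apply/rowP => i; rewrite mxE; apply/eqP.
have /eqP := E i; rewrite -natrB // d0 mulf_eq0 pnatr_eq0.
by rewrite eqn0Ngt N0.
Qed.

Lemma positive_additive_form : exists f : H -> rat,
  {morph f : x y / mmul x y >-> x + y} /\ forall i, 0 < f (a i).
Proof.
have [||C CP] := @subspace_kernel _ _ relation.
- exists 1%N, (fun=> 0%N), (fun=> 0%N); split=> // i.
  by rewrite mxE mulr0 subrr.
- by move=> c w w' rw rw'; apply/relationD/rw'/relation_scale.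
have [c c0 cC|l lP] := @stiemke _ _ _ C.
  by apply: relation_ge0 => //; apply/CP.
(* The weights [C *m l] are positive and orthogonal to every relation, so [val u] depends only on
   the element [pow_prod u]. *)
pose y i := (C *m l) i 0; pose val u := \sum_i (u i)%:R * y i.
have val_eq u v : pow_prod u = pow_prod v -> val u = val v.
  move=> uv; apply/eqP; rewrite -subr_eq0 -sumrB; apply/eqP.
  have /CP E : relation (\row_i ((u i)%:R - (v i)%:R)).
    by exists 1%N, u, v; split=> // i; rewrite mxE mul1r.
  have /matrixP/(_ 0 0) := congr1 (mulmx^~ l) E.
  rewrite /= mul0mx -mulmxA !mxE => E'; rewrite -[RHS]E'.
  by apply: eq_bigr => i _; rewrite !mxE -mulrBl /y mxE.
(* The exponents chosen for a product need not be the sum of those of its factors; [val_eq] absorbs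
   the difference. *)
have [e eP] := choice gen.
exists (val \o e); split=> [x x'|i] /=.
  rewrite -big_split /=.
  under [RHS]eq_bigr do rewrite -mulrDl -natrD.
  by apply: (val_eq _ (fun i => e x i + e x' i)%N); rewrite pow_prodD -!eP.
rewrite (val_eq _ (fun j => (j == i) : nat)); last by rewrite pow_prod1 -eP.
rewrite /val (bigD1 i) //= eqxx mul1r big1 ?addr0; first exact: lP.
by move=> j /negPf->; rewrite mul0r.
Qed.

End PowerProducts.

(** The unit is removed from the generators because no additive form is positive on it. *)
Lemma generates_pow_prod (H : conomType) (A : {fset H}) : generates A ->
  exists n (a : 'I_n -> H), [/\ forall i, a i <> mone,
    forall x, x \in A -> x = mone \/ exists i, x = a i &
    forall h, exists u, h = pow_prod a u].
Proof.
move=> genA; pose s := [seq x <- A | x != mone].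
have sP x : x \in A -> x = mone \/ exists i, x = tnth (in_tuple s) i.
  move=> xA; have [->|x1] := eqVneq x mone; [by left|right].
  by apply/tnthP; rewrite /= mem_filter x1.
exists (size s), (tnth (in_tuple s)); split=> // [i|h].
  have : tnth (in_tuple s) i \in s by apply: mem_tnth.
  by rewrite mem_filter => /andP[/eqP].
have [t tA ->] := genA h; elim: t tA => [|x t IHt] tA.
  by exists (fun=> 0%N); rewrite pow_prod0 big_nil.
have [|u uE] := IHt; first by move=> z zt; apply: tA; rewrite inE zt orbT.
rewrite big_cons uE; case: (sP x) => [|->|[i ->]]; first by rewrite tA ?inE ?eqxx.
  by exists u; rewrite mul1m.
by exists (fun j => (j == i) + u j)%N; rewrite pow_prodD pow_prod1.
Qed.

(** The linear extension of [f] to the free space kills each [add_rel] by additivity, so it is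
    constant on classes and can be evaluated on representatives. *)
Lemma additive_QH_form (H : conomType) (f : H -> rat) :
    {morph f : x y / mmul x y >-> x + y} ->
  exists L : {scalar QH H}, forall h, L (toQH h) = f h.
Proof.
move=> fM; pose F (g : {malg rat[H]}) := \sum_(h <- msupp g) g@_h * f h.
have Fw (d : {fset H}) g : (msupp g `<=` d)%fset -> F g = \sum_(h <- d) g@_h * f h.
  move=> le; rewrite [LHS](big_fset_incl _ le) => //= x xd /mcoeff_outdom ->.
  by rewrite mul0r.
have FU h : F << h >> = f h.
  by rewrite (Fw _ _ msuppU_le) big_seq_fset1 mcoeffUU mul1r.
have FD c g g' : F (c *: g + g') = c * F g + F g'.
  pose d := (msupp g `|` msupp g')%fset.
  rewrite !(Fw d) ?fsubsetUl ?fsubsetUr //; last first.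
    apply: fsubset_trans (msuppD_le _ _) _.
    by apply: fsetSU; apply: msuppZ_le.
  rewrite mulr_sumr -big_split; apply: eq_bigr => h _ /=.
  by rewrite mcoeffD mcoeffZ mulrDl mulrA.
pose Fl := HB.pack_for {scalar {malg rat[H]}} F (GRing.isLinear.Build _ _ _ _ F FD).
have FB g g' : F (g - g') = F g - F g' := linearB Fl g g'.
have FZ c g : F (c *: g) = c * F g := linearZ_LR Fl c g.
have Fker g : g \in @add_rels H -> F g = 0.
  case/asboolP => s ->; rewrite -[F]/(Fl : _ -> _) linear_sum big1 // => t _.
  by rewrite /= FZ /add_rel !FB !FU fM addrAC addrK subrr mulr0.
pose L (v : QH H) := F (repr v).
have LE g : L (\pi_(QH H) g) = F g.
  apply/eqP; rewrite -subr_eq0; apply/eqP.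
  rewrite -FB; apply: Fker.
  by apply/QH_eqP; rewrite reprK.
have LD c v w : L (c *: v + w) = c * L v + L w.
  elim/QH_ind: v => g; elim/QH_ind: w => g'.
  have -> : c *: (\pi_(QH H) g) = \pi_(QH H) (c *: g) by apply: QH_scaleE.
  by rewrite -QH_piD !LE FD.
exists (HB.pack_for {scalar QH H} L (GRing.isLinear.Build _ _ _ _ L LD)) => h.
by rewrite /= LE FU.
Qed.

Lemma toQHM (H : conomType) : {morph @toQH H : x y / mmul x y >-> x + y}.
Proof.
move=> x y; rewrite -QH_piD; apply/QH_eqP/asboolP; exists [:: (1, (x, y))].
by rewrite big_seq1 scale1r /add_rel /= opprD addrA.
Qed.

Lemma toQH1 (H : conomType) : toQH (mone : H) = 0.
Proof. by apply: (addIr (toQH mone)); rewrite -toQHM mul1m add0r. Qed.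

Lemma toQH_pow (H : conomType) (x : H) k : toQH (mpow x k) = k%:R *: toQH x.
Proof.
elim: k => [|k IHk]; first by rewrite scale0r -toQH1.
by rewrite /mpow /= toQHM -/(mpow x k) IHk mulrS scalerDl scale1r.
Qed.

Lemma toQH_pow_prod (H : conomType) n (a : 'I_n -> H) u :
  toQH (pow_prod a u) = \sum_i (u i)%:R *: toQH (a i).
Proof.
rewrite /pow_prod (big_morph _ (@toQHM H) (@toQH1 H)).
by apply: eq_bigr => i _; rewrite toQH_pow.
Qed.

Lemma pow_prod_span (H : conomType) n (a : 'I_n -> H) :
    (forall h, exists u, h = pow_prod a u) ->
  forall x : QH H, exists c : 'rV[rat]_n, x = \sum_i c 0 i *: toQH (a i).
Proof.
move=> gen; elim/QH_ind => g; rewrite [g]monalgE.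
elim: (X in \sum_(_ <- X) _) => [|h s [c IH]].
  exists 0; rewrite big_nil big1 => [|i _]; last by rewrite mxE scale0r.
  by rewrite piE.
have [u uE] := gen h; exists (g@_h *: \row_i (u i)%:R + c).
under [RHS]eq_bigr do rewrite !mxE scalerDl.
rewrite big_cons QH_piD IH big_split /=; congr (_ + _).
have -> : << g@_h *g h >> = g@_h *: << h >> :> {malg rat[H]}.
  by apply/malgP => k; rewrite mcoeffZ !mcoeffU mulrnAr mulr1.
rewrite -[LHS]QH_scaleE -/(toQH h) [toQH h](congr1 (@toQH H) uE) toQH_pow_prod.
rewrite -[LHS]/(g@_h *: (\sum_i (u i)%:R *: toQH (a i) : QH H)).
rewrite scaler_sumr; apply: eq_bigr => i _.
by rewrite scalerA.
Qed.

Lemma common_multiple n (y : 'I_n -> rat) : (forall i, 0 < y i) ->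
  exists2 s : rat, 0 < s & exists k : 'I_n -> nat, forall i, s * y i * (k i)%:R = 1.
Proof.
move=> y0; pose p i := `|numq (y i)|%N; pose q i := `|denq (y i)|%N.
have p0 i : (0 < p i)%N by rewrite absz_gt0 numq_eq0 gt_eqF.
have pqE i : y i * (q i)%:R = (p i)%:R.
  rewrite /p /q !natr_absz !gtr0_norm ?denq_gt0 ?numq_gt0 //.
  by rewrite -{1}[y i]divq_num_den divfK // intr_eq0 denq_neq0.
have P0 : 0 < (\prod_i p i)%:R :> rat by rewrite ltr0n prodn_gt0.
(* With [y i = p i / q i], dividing by the product of all numerators is undone by [q i] times the
   product of the other numerators. *)
exists (\prod_i p i)%:R^-1; first by rewrite invr_gt0.
exists (fun i => q i * \prod_(j | j != i) p j)%N => i.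
rewrite natrM -!mulrA [y i * _]mulrA pqE -natrM.
have <- : (\prod_j p j = p i * \prod_(j | j != i) p j)%N by rewrite (bigD1 i).
by rewrite mulVf ?gt_eqF.
Qed.

(** * The Newton degree *)

Lemma newton_polytope_le1 (H : conomType) (A : {fset H}) (L : {scalar QH H}) :
    (forall x, x \in A -> L (toQH x) <= 1) ->
  forall x, newton_polytope A x -> L x <= 1.
Proof.
move=> LA x [n [p [c [pA c0 c1 ->]]]]; rewrite linear_sum -c1.
apply: ler_sum => i _; rewrite linearZ -[leRHS]mulr1; apply: ler_wpM2l => //.
by case: (pA i) => [[y /LA Ly ->]|->] //; rewrite linear0.
Qed.

Section SingleFacet.
Variables (H : conomType) (A : {fset H}) (n : nat) (a : 'I_n -> H).
Variables (k : 'I_n -> nat) (L : {scalar QH H}).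
Hypothesis gen : forall h, exists u, h = pow_prod a u.
Hypothesis L_le1 : forall x, x \in A -> L (toQH x) <= 1.
Hypothesis kA : forall i, mpow (a i) (k i) \in A.
Hypothesis kL : forall i, L (toQH (mpow (a i) (k i))) = 1.

Let top_facet := [set x | newton_polytope A x /\ L x = 1]%classic.

Let k_neq0 i : (k i)%:R != 0 :> rat.
Proof.
apply/eqP => k0; have /eqP := kL i.
by rewrite toQH_pow k0 scale0r linear0 eq_sym oner_eq0.
Qed.

(** Nonzero multiples of a basis drawn from the generators give [r] independent points on [L = 1].
    Conversely, applying [L] to a linear dependency among points of this hyperplane shows that its
    coefficients sum to 0, so affine independence there implies linear independence. *)
Lemma newton_facet_top : newton_facet A top_facet.
Proof.
have [r [f [ind rk]]] := spanning_rank (pow_prod_span gen).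
exists r => //; split; last by case=> _ /eqP; rewrite linear0 eq_sym oner_eq0.
  by exists L, 1; split=> //; apply: newton_polytope_le1.
split=> [|m p pS paff].
  exists (fun j => toQH (mpow (a (f j)) (k (f j)))); split=> [i|c _ c0 i].
    by split; [apply: newton_polytopeA|].
  have := ind (fun j => c j * (k (f j))%:R) _ i => /(_ _)/eqP.
  rewrite mulf_eq0 (negPf (k_neq0 _)) orbF => E; apply/eqP/E.
  by rewrite -[RHS]c0; apply: eq_bigr => j _; rewrite toQH_pow scalerA.
apply: (rk.2 _ p) => c c0; apply: paff => //.
have := congr1 L c0; rewrite linear_sum linear0 => E; rewrite -[RHS]E.
by apply: eq_bigr => j _; rewrite linearZ /= (pS j).2 mulr1.
Qed.

(** The index [i] provides a point at which [L] attains 1; with no generators [top_facet] is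
    empty. *)
Lemma facet_form_top (i : 'I_n) : facet_form A top_facet L.
Proof.
split; last by apply/seteqP; split=> x [].
split; first by exists (toQH (mpow (a i) (k i))); [apply: newton_polytopeA|].
by move=> _ [x /(newton_polytope_le1 L_le1) Lx <-].
Qed.

(** As a facet form, [L] bounds the degree from below. Any facet form is at most 1, the value of
    [L], at [mpow (a j) (k j)], hence at most [L] on each generator and on all of [H]. *)
Lemma newton_deg_single_facet h : newton_deg A h = L (toQH h).
Proof.
have [u ->] := gen h.
have [i _|n0] := pickP 'I_n; last first.
  (* Without generators [H] is trivial and the degree is 0 by convention. *)
  have -> : pow_prod a u = mone.
    by apply: big1 => i; have := n0 i.
  by rewrite newton_deg_unit toQH1 linear0.
have Lval : newton_values A (pow_prod a u) (L (toQH (pow_prod a u))).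
  exists top_facet, L; split=> //; first exact: newton_facet_top.
  exact: facet_form_top i.
have [|[S [l [_ Fl ->]]] maxl] := @newton_degP H A (pow_prod a u).
  by exists (L (toQH (pow_prod a u))).
apply/eqP; rewrite eq_le maxl // andbT toQH_pow_prod !linear_sum.
apply: ler_sum => j _; rewrite !linearZ; apply: ler_wpM2l; first exact: ler0n.
have := facet_form_le Fl (newton_polytopeA (kA j)).
rewrite -(kL j) toQH_pow !linearZ /= ler_pM2l //.
by rewrite lt0r k_neq0 ler0n.
Qed.

End SingleFacet.

Lemma linear_newton_deg (H : conomType) : affine_semigroup H ->
  exists A : {fset H}, generates A /\
    exists L : {scalar QH H}, forall h, newton_deg A h = L (toQH h).
Proof.
move=> [[A0 gA0] canc _].
have [n [a [a1 aA gen]]] := generates_pow_prod gA0.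
have [f [fM f0]] := positive_additive_form gen canc a1.
have [s s0 [k kP]] := common_multiple f0.
have [x y|L LE] := @additive_QH_form _ (fun h => s * f h).
  by rewrite fM mulrDr.
have kL i : L (toQH (mpow (a i) (k i))) = 1.
  by rewrite toQH_pow linearZ /= LE mulrC.
pose A := (A0 `|` [fset mpow (a i) (k i) | i in 'I_n])%fset.
exists A; split.
  move=> h; have [t tA hE] := gA0 h; exists t => // x /tA xA.
  by rewrite !inE xA.
exists L => h; apply: (newton_deg_single_facet gen) => // [x|i]; last first.
  by rewrite !inE; apply/orP; right; apply/imfsetP; exists i.
rewrite !inE => /orP[/aA[->|[i ->]]|/imfsetP[i _ ->]]; last by rewrite kL.
  by rewrite toQH1 linear0.
(* Since [k i] is at least 1, the value of [L] at [a i] is at most its value 1 at the multiple. *)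
rewrite -(kL i) toQH_pow linearZ /= ler_peMl //.
  by rewrite LE mulr_ge0 ?ltW.
rewrite ler1n lt0n; apply/eqP => k0; have /esym/eqP := kP i.
by rewrite k0 mulr0 oner_eq0.
Qed.

(** * The associated graded ring of an additive degree *)

Section GradedIso.
Variables (K : fieldType) (H : conomType) (A : {fset H}).
Hypothesis degM : {morph @newton_deg H A : x y / mmul x y >-> x + y}.

Local Notation deg := (newton_deg A).
Local Notation N := (newton_filtration K A).

Lemma qgr_coefU (R : comNzRingType) (c : R) (i j : rat) :
  (<< c *g i >> : qgroup_ring R)@_j = c *+ (i == j).
Proof. exact: mcoeffU. Qed.

(** Placing each monomial at the exponent of its own degree is multiplicative because the degree is
    additive. *)
Definition hom_mon (h : H) : qgroup_ring {malg K[H]} := << << h >> *g deg h >>.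

Definition hom_const (c : K) : qgroup_ring {malg K[H]} := << c%:MP *g 0 >>.

Fact hom_const_zmod_morphism : zmod_morphism hom_const.
Proof. by move=> c d; rewrite /hom_const !raddfB. Qed.

Fact hom_const_monoid_morphism : monoid_morphism hom_const.
Proof.
split=> [|c d] //.
by rewrite [RHS]qgr_mulUU addr0 -rmorphM.
Qed.

HB.instance Definition _ :=
  GRing.isZmodMorphism.Build K _ hom_const hom_const_zmod_morphism.
HB.instance Definition _ :=
  GRing.isMonoidMorphism.Build K _ hom_const hom_const_monoid_morphism.

Fact hom_mon_multiplicative : mmorphism hom_mon.
Proof.
split=> [h h'|]; last by rewrite /hom_mon newton_deg_unit.
rewrite [RHS]qgr_mulUU /hom_mon degM; congr << _ *g _ >>.
by rewrite [RHS]fgmulUU mulr1.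
Qed.

HB.instance Definition _ :=
  isMultiplicative.Build H _ hom_mon hom_mon_multiplicative.

(** This is the decomposition into homogeneous components; building it with [mmap] makes it a ring
    morphism. *)
Definition hom_rees : {malg K[H]} -> qgroup_ring {malg K[H]} :=
  mmap hom_const hom_mon.

HB.instance Definition _ := GRing.RMorphism.on hom_rees.

Lemma hom_reesE f k h : (hom_rees f)@_k@_h = f@_h *+ (deg h == k).
Proof.
rewrite /hom_rees /mmap !raddf_sum /=.
under eq_bigr => h' _.
  rewrite [_ * _]qgr_mulUU add0r mcoeffU mul_malgC raddfMn /= mcoeffZ mcoeffU1.
  rewrite mulr_natr -mulrnA.
  over.
have [hf|hf] := boolP (h \in msupp f).
  rewrite (big_fsetD1 h) //= eqxx mul1n big1_fset ?addr0 // => h'.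
  by rewrite !inE => /andP[/negPf->]; rewrite mulr0n.
rewrite (mcoeff_outdom hf) mul0rn big1_fset // => h' h'f _.
by case: eqP h'f hf => [-> ->|]; rewrite ?mulr0n.
Qed.

Lemma hom_rees_mem f : hom_rees f \in rees_pred N.
Proof.
apply/asboolP => k; apply/newton_filP => h; rewrite hom_reesE.
by case: (deg h =P k) => [->|]; rewrite ?mulr0n ?eqxx.
Qed.

Definition to_rees f : rees N := Rees (hom_rees_mem f).

Fact to_rees_zmod_morphism : zmod_morphism to_rees.
Proof. by move=> f f'; apply: val_inj; rewrite rmorphB /= rmorphB. Qed.

Fact to_rees_monoid_morphism : monoid_morphism to_rees.
Proof.
by split=> [|f f']; apply: val_inj; rewrite ?rmorph1 ?rmorphM /= ?rmorph1 ?rmorphM.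
Qed.

HB.instance Definition _ :=
  GRing.isZmodMorphism.Build _ _ to_rees to_rees_zmod_morphism.
HB.instance Definition _ :=
  GRing.isMonoidMorphism.Build _ _ to_rees to_rees_monoid_morphism.

(** The support is finite, so the maximum of [k - 1] and the degrees that occur is a uniform bound
    still below [k]. *)
Lemma newton_fil_ltP k f :
  reflect (forall h, f@_h != 0 -> deg h < k) (f \in fil_lt N k).
Proof.
apply: (iffP (asboolP _)) => [[j jk /newton_filP fj] h /fj|fk].
  by move/le_lt_trans; apply.
have /(_ (msupp f)) H1 (s : seq H) : {in s, forall h, deg h < k} ->
    exists2 j, j < k & {in s, forall h, deg h <= j}.
  elim: s => [|h s IHs] sk; first by exists (k - 1); rewrite ?gtrBl.
  have [|j jk sj] := IHs; first by move=> h' h's; apply: sk; rewrite inE h's orbT.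
  exists (Num.max (deg h) j); first by rewrite gt_max jk sk ?inE ?eqxx.
  by move=> h'; rewrite inE le_max => /predU1P[->|/sj->]; rewrite ?lexx ?orbT.
have [h|j jk fj] := H1; first by rewrite -mcoeff_neq0; apply: fk.
by exists j => //; apply/newton_filP => h; rewrite mcoeff_neq0; apply: fj.
Qed.

Definition to_graded : {malg K[H]} -> newton_graded_ring K A :=
  \pi_{ideal_quot @rees_lt _ N} \o to_rees.

HB.instance Definition _ := GRing.RMorphism.on to_graded.

Lemma graded_eqP (x y : rees N) :
  reflect (\pi_{ideal_quot @rees_lt _ N} x = \pi_{ideal_quot @rees_lt _ N} y)
    (x - y \in @rees_lt _ N).
Proof. by rewrite Quotient.idealrBE; apply: (iffP eqP). Qed.

(** A monomial [h] in which [f] and [f'] differ occurs in the difference of their images at exponent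
    [deg h], where the ideal admits only degrees strictly below [deg h]. *)
Lemma to_graded_inj : injective to_graded.
Proof.
move=> f f' /graded_eqP/asboolP lt; apply/malgP => h; apply/eqP.
rewrite -subr_eq0 -mcoeffB; apply: contraT => neq0.
have /newton_fil_ltP/(_ h) := lt (deg h).
by rewrite -rmorphB /= hom_reesE eqxx neq0 ltxx => /(_ isT).
Qed.

Lemma to_graded_surj y : exists f, to_graded f = y.
Proof.
rewrite -[y]reprK; set x := repr y; have /asboolP xN := valP x.
(* Only the coefficient of [h] at the exponent [deg h] survives in the quotient, so [f] collects
   these; [D] is a finite set containing every monomial of [x]. *)
pose D := (\bigcup_(k <- msupp (\val x)) msupp (\val x)@_k)%fset.
pose f : {malg K[H]} := [malg h in D => (\val x)@_(deg h)@_h]%R.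
have fE h : f@_h = (\val x)@_(deg h)@_h.
  rewrite mcoeffE; case: ifP => // /negbT; apply: contraNeq.
  rewrite eq_sym => neq0; apply/bigfcupP; exists (deg h).
    by rewrite andbT -mcoeff_neq0; apply: contraNneq neq0 => ->; rewrite mcoeff0.
  by rewrite -mcoeff_neq0.
exists f; apply/esym/graded_eqP/asboolP => k; apply/newton_fil_ltP => h.
rewrite rmorphB /= !mcoeffB hom_reesE fE.
have [->|neq] := eqVneq (deg h) k; first by rewrite subrr eqxx.
(* Away from the exponent [deg h] the filtration bound [deg h <= k] is strict, so the remaining
   terms lie in the ideal. *)
rewrite mulr0n subr0 lt_neqAle neq /=.
by have /newton_filP := xN k; apply.
Qed.

Lemma to_graded_bij : bijective to_graded.
Proof.
have [g gK] := choice to_graded_surj.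
by exists g => // f; apply: to_graded_inj; rewrite gK.
Qed.

End GradedIso.

(** * Cohen-Macaulayness and isomorphisms *)

Section PreimageOfIdeals.
Variables (R S : comNzRingType) (f : {rmorphism R -> S}) (g : S -> R).
Hypotheses (fK : cancel f g) (gK : cancel g f).

(** Ideals are predicates, so they cross the isomorphism by preimage, along [f] or along its
    inverse. *)
Definition preim_pred (I : {pred S}) : {pred R} := fun x => f x \in I.

Lemma preim_predE I x : (x \in preim_pred I) = (f x \in I).
Proof. by []. Qed.

Lemma preim_idealr_closed I : idealr_closed I -> idealr_closed (preim_pred I).
Proof.
case=> I0 I1 ID; split; rewrite ?preim_predE ?rmorph0 ?rmorph1 // => a x y.
by rewrite !preim_predE rmorphD rmorphM => xI yI; apply: ID.
Qed.

Lemma preim_prime_ideal I : prime_ideal I -> prime_ideal (preim_pred I).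
Proof.
case=> II IP; split; first exact: preim_idealr_closed.
by move=> x y; rewrite !preim_predE rmorphM; apply: IP.
Qed.

(** Surjectivity of [f] keeps the inclusions strict. *)
Lemma preim_prime_chain P n C : prime_chain P n C ->
  prime_chain (preim_pred P) n (fun i => preim_pred (C i)).
Proof.
case=> Cp Cs CP; split=> [i /Cp|i /Cs[sub nsub]|x]; last exact: CP.
  exact: preim_prime_ideal.
split=> [x|h]; first exact: sub.
by apply: nsub => y yC; have := h (g y); rewrite !preim_predE gK; apply.
Qed.

Lemma mem_ideal_gen_map s x : (f x \in ideal_gen (map f s)) = (x \in ideal_gen s).
Proof.
apply/asboolP/asboolP; rewrite size_map => -[c cE].
  exists (g \o c); apply: (can_inj fK); rewrite cE rmorph_sum.
  by apply: eq_bigr => i _; rewrite rmorphM /= gK (nth_map 0).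
exists (f \o c); rewrite cE rmorph_sum.
by apply: eq_bigr => i _; rewrite rmorphM /= (nth_map 0).
Qed.

Lemma regular_sequence_map s : regular_sequence s -> regular_sequence (map f s).
Proof.
case=> s1 sreg; split; first by rewrite -(rmorph1 f) mem_ideal_gen_map.
move=> i y; rewrite size_map => lt_is; rewrite (nth_map 0) // -[y]gK -rmorphM.
by rewrite -map_take !mem_ideal_gen_map; apply: sreg.
Qed.

End PreimageOfIdeals.

(** Depth and codimension of [M] are those of its preimage: optimal sequences and chains are carried
    from [R] to [S], and the bounds on their lengths follow by carrying those of [S] back to [R]. *)
Lemma cohen_macaulay_iso (R S : comNzRingType) (f : {rmorphism R -> S}) :
  bijective f -> cohen_macaulay R -> cohen_macaulay S.
Proof.
case=> g0 fK0 gK0 [noethR cmR].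
(* The inverse is packed as a ring morphism so that the preceding lemmas apply in both
   directions. *)
pose g := HB.pack_for {rmorphism S -> R} g0
  (GRing.isZmodMorphism.Build _ _ g0 (can2_zmod_morphism fK0 gK0))
  (GRing.isMonoidMorphism.Build _ _ g0 (can2_monoid_morphism fK0 gK0)).
have [fK gK] : cancel f g /\ cancel g f by [].
split=> [I II|M [MI Mmax]].
  have [s sE] := noethR _ (preim_idealr_closed f II).
  exists (map f s) => y; rewrite -[y]gK (mem_ideal_gen_map fK gK) -sE.
  by rewrite preim_predE.
have mM : maximal_ideal (preim_pred f M).
  split=> [|J JI MJ x]; first exact: preim_idealr_closed.
  have E := Mmax _ (preim_idealr_closed g JI).
  rewrite !preim_predE -E ?preim_predE ?fK // => y yM.
  by rewrite preim_predE MJ // preim_predE gK.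
have [n [[s [sreg sM sn]] dmax] [[C Cch] cmax]] := cmR _ mM; exists n; split.
- exists (map f s); split; last by rewrite size_map.
  + exact: (regular_sequence_map fK gK).
  + by move=> _ /mapP[x /sM xM ->].
- move=> t treg tM; rewrite -(size_map g); apply: dmax.
    exact: (regular_sequence_map gK fK).
  by move=> _ /mapP[y /tM yM ->]; rewrite preim_predE gK.
- exists (fun i => preim_pred g (C i)).
  have [Cp Cs CP] := preim_prime_chain fK Cch; split=> // y.
  by rewrite CP !preim_predE gK.
- move=> m D Dch; exact: (cmax _ _ (preim_prime_chain gK Dch)).
Qed.

Theorem mainTheorem1 (K : fieldType) (H : conomType) (affH : affine_semigroup H) :
  exists A : {fset H}, generates A /\
    (cohen_macaulay {malg K[H]} -> cohen_macaulay (newton_graded_ring K A)).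
Proof.
have [A [genA [L degL]]] := linear_newton_deg affH.
have degM : {morph @newton_deg H A : x y / mmul x y >-> x + y}.
  by move=> x y; rewrite !degL toQHM linearD.
exists A; split=> //; exact: cohen_macaulay_iso (to_graded_bij K degM).
Qed.
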